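(* Consider the AURWM regime (defined in the context) with $n=\lfloor p^k\rfloor$ for some fixed $k\in(0,1)$. Let $\mathcal{T}$ be the class of all marginal screening estimators $\widehat{\mathcal S}_\tau$ with $\tau:\mathbb{R}^{n\times p}\times\mathbb{R}^n\to[0,\infty)$. Then no marginal screening estimator achieves asymptotic exact recovery; precisely, $$\lim_{p\to\infty}\ \inf_{\widehat{\mathcal S}_\tau\in\mathcal{T}}\ \sup_{\beta\in\mathcal{M}_s^a}\ \mathbb{P}_\beta\big(\widehat{\mathcal S}_\tau\neq\mathcal{S}(\beta)\big)=1.$$
   Context: Model: $Y=X\beta+E$, where $X\in\mathbb{R}^{n\times p}$ has i.i.d. rows $x_i\sim N_p(0,I_p)$, $E=(\varepsilon_1,\dots,\varepsilon_n)^\top$ has i.i.d. $N(0,1)$ entries, and $X,E$ are independent. $X_j\in\mathbb{R}^n$ denotes the $j$th column of $X$. $\mathbb{P}_\beta$ is the law of the data when the coefficient vector is $\beta\in\mathbb{R}^p$. $\mathcal{S}(v)=\{j: v_j\neq 0\}$ is the support of $v\in\mathbb{R}^p$, and $\|v\|_0=|\mathcal{S}(v)|$. Signal class: $\mathcal{M}_s^a=\{\beta\in\mathbb{R}^p:\ \|\beta\|_0=s,\ \min_{j\in\mathcal{S}(\beta)}|\beta_j|\ge a\}$. AURWM (Asymptotically Ultra Rare and Weak Minimum signal) regime: $p\to\infty$, $n=\lfloor p^k\rfloor$ with fixed $k\in(0,1)$, sparsity $s=s_p=O(\log p)$, and $a=\left(\frac{2r\log p}{n}\right)^{1/2}$ where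 $r>0$ is a fixed constant (signal strength parameter). Marginal screening: for $j\in[p]=\{1,\dots,p\}$ let $\mu_j=X_j^\top Y/n$. Given a (possibly data-driven) nonnegative threshold function $\tau(X,Y)$, the marginal screening estimator is $\widehat{\mathcal S}_\tau=\{j\in[p]:\ |\mu_j|\ge\tau(X,Y)\}$.
   Formalization: The formal theorem takes measurable thresholds and assumes that for all large p either s≥2, or s=1 and r<1; otherwise the claim fails: for s=0 a large threshold never errs, and for s=1, r≥1 the threshold max|μ_j| keeps the limiting error at most 1/2. *)

(* Defs.v *)
From HB Require Import structures.
From mathcomp Require Import all_boot all_order all_algebra.
From mathcomp Require Import all_classical all_reals all_analysis.
From mathcomp Require Import measurable_realfun.

Set Implicit Arguments.
Unset Strict Implicit.
Unset Printing Implicit Defensive.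

Import Order.TTheory GRing.Theory Num.Theory.
Import numFieldNormedType.Exports.

Local Open Scope classical_set_scope.
Local Open Scope ring_scope.

Section iid_law.
Context d (T : measurableType d) (R : realType).

Definition cons_pair n (xt : T * n.-tuple T) : n.+1.-tuple T :=
  [tuple of xt.1 :: xt.2].

Lemma measurable_cons_pair n : measurable_fun setT (@cons_pair n).
Proof. exact: measurable_cons. Qed.

HB.instance Definition _ n :=
  isMeasurableFun.Build _ _ _ _ (@cons_pair n) (@measurable_cons_pair n).

Variable P : probability T R.

(* The n-fold power of P on T^n, i.e. the law of n independent draws from P,
   built from the binary product along T * T^n ~ T^(n+1). *)
Fixpoint iid_law n : probability (n.-tuple T) R :=
  match n with
  | 0 => \d_([tuple] : 0.-tuple T)
  | m.+1 => distribution (P \x iid_law m)%E (@cons_pair m)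
  end.

End iid_law.

Section linear_model.
Variable R : realType.

(* A design matrix is given by the tuple of its rows. *)
Definition design n p := n.-tuple (p.-tuple R).

(* A sample is a pair (X, Y). *)
Definition sample n p := (design n p * n.-tuple R)%type.

(* normal_prob is a measure on measurableTypeR R, which has the same measurable
   sets as R but another display: the identity transports it to R. *)
Definition of_measurableTypeR : measurableTypeR R -> R := idfun.

Lemma measurable_of_measurableTypeR : measurable_fun setT of_measurableTypeR.
Proof. by move=> _ A mA; rewrite setTI. Qed.

HB.instance Definition _ :=
  isMeasurableFun.Build _ _ _ _ of_measurableTypeR measurable_of_measurableTypeR.

Definition std_normal : probability R R :=
  distribution (normal_prob (0 : R) 1) of_measurableTypeR.

Definition design_noise_law n p : probability (design n p * n.-tuple R)%type R :=
  (iid_law (iid_law std_normal p) n \x iid_law std_normal n)%E.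

(* (X, E) |-> (X, X beta + E) *)
Definition observe n p (beta : p.-tuple R) (xe : design n p * n.-tuple R) :
    sample n p :=
  (xe.1, [tuple \sum_(j < p) tnth (tnth xe.1 i) j * tnth beta j + tnth xe.2 i
         | i < n]).

Lemma measurable_observe n p (beta : p.-tuple R) :
  measurable_fun setT (@observe n p beta).
Proof.
apply: measurable_fun_pair; first exact: measurable_fst.
apply/measurable_fun_tnthP => i.
have -> : (@tnth n R)^~ i \o (fun xe : design n p * n.-tuple R =>
    [tuple \sum_(j < p) tnth (tnth xe.1 k) j * tnth beta j + tnth xe.2 k
    | k < n]) =
  (fun xe => \sum_(j < p) tnth (tnth xe.1 i) j * tnth beta j + tnth xe.2 i).
  by apply/funext => xe /=; rewrite tnth_mktuple.
apply: measurable_funD.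
  apply: measurable_sum => j; apply: measurable_funM => //.
  apply: (measurableT_comp (@measurable_tnth _ _ p j)).
  apply: (measurableT_comp (@measurable_tnth _ (p.-tuple R) n i)).
  exact: measurable_fst.
apply: (measurableT_comp (@measurable_tnth _ R n i)).
exact: measurable_snd.
Qed.

HB.instance Definition _ n p (beta : p.-tuple R) :=
  isMeasurableFun.Build _ _ _ _ (@observe n p beta) (@measurable_observe n p beta).

(* P_beta *)
Definition data_law n p (beta : p.-tuple R) : probability (sample n p) R :=
  distribution (design_noise_law n p) (@observe n p beta).

Definition support p (v : p.-tuple R) : {set 'I_p} :=
  [set j | tnth v j != 0]%SET.

(* M_s^a *)
Definition signal_class p (s : nat) (a : R) : set (p.-tuple R) :=
  [set beta | #|support beta| = s /\
              forall j, j \in support beta -> a <= `|tnth beta j|].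

(* mu_j = X_j^T Y / n *)
Definition marginal n p (xy : sample n p) (j : 'I_p) : R :=
  (\sum_(i < n) tnth (tnth xy.1 i) j * tnth xy.2 i) / n%:R.

Definition marginal_screening n p (tau : sample n p -> R) (xy : sample n p) :
    {set 'I_p} :=
  [set j | tau xy <= `|marginal xy j|]%SET.

Definition threshold n p : set (sample n p -> R) :=
  [set tau : sample n p -> R | measurable_fun setT tau /\ forall xy, 0 <= tau xy].

Definition error_prob n p (tau : sample n p -> R) (beta : p.-tuple R) : \bar R :=
  data_law n beta [set xy | marginal_screening tau xy != support beta].

Definition ms_minimax_risk n p (s : nat) (a : R) : \bar R :=
  ereal_inf [set ereal_sup [set error_prob tau beta |
                            beta in @signal_class p s a] |
             tau in @threshold n p].

Definition sample_size (k : R) (p : nat) : nat := Num.truncn (p%:R `^ k).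

Definition signal_level (k r : R) (p : nat) : R :=
  Num.sqrt (2 * r * ln p%:R / (sample_size k p)%:R).

End linear_model.

(* Main.v *)
Require Import Defs.
From HB Require Import structures.
From mathcomp Require Import all_boot all_order all_algebra.
From mathcomp Require Import all_classical all_reals all_analysis.
From mathcomp Require Import measurable_realfun ring lra.

Set Implicit Arguments.
Unset Strict Implicit.
Unset Printing Implicit Defensive.

Import Order.TTheory GRing.Theory Num.Theory.
Import numFieldNormedType.Exports.

Local Open Scope classical_set_scope.
Local Open Scope ring_scope.

(** Why the risk tends to 1.  Fix a threshold [tau].  Take coefficient vectors
    [beta^j] that share [s - 1] strong entries of size [B] at the first
    coordinates and have one weak entry, of the minimal size [a], at a position
    [j] among the remaining [m = p - (s - 1)] coordinates ([spiked_signal]).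
    Whatever [tau] is, screening can recover the support of [beta^j] only if
    [|mu_j|] strictly exceeds all the null marginals: call this event of the
    data [leading j].  The events [leading j] are pairwise disjoint, so a data
    law not depending on [j] would give them total mass at most 1, that is
    [1/m] on average.

    The law under [beta^j] is compared with the one under the strong part
    alone by a Gaussian change of measure.  If [s = 1], the weak signal [a X_j]
    is absorbed by the noise: [a X_j + E] is a translate of [E], with [t = a].
    If [s >= 2], it is absorbed by the first column: with [a = t B] one has
    [a X_j + B X_0 = B (X_0 + t X_j)], and the marginals that are compared do
    not involve the column [X_0] itself; only the response does.  In both
    cases the absorbing vector [Z] is standard Gaussian and independent of
    [X_j], and by Cameron-Martin the translation has the likelihood ratio
    [exp l], [l = t <X_j, Z> - t^2 |X_j|^2 / 2] ([gaussian_tilt_noise],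
    [gaussian_tilt_head]).

    Splitting according to [l <= lam] or not gives, for every [th >= 0],
    [exp l * 1_D <= exp lam * 1_D + exp ((1 + th) l - th lam)].  Summing over
    [j], the probabilities of recovery add up to at most
    [exp lam + m exp (c - th lam)], where [exp c] bounds the moment of
    [exp ((1 + th) l)] ([sum_tilted_disjoint_le]); this moment equals that of
    [exp (u |X_j|^2 / 2)], [u = th (1 + th) t^2], which factorizes over the [n]
    observations and gives [c = n u / (2 (1 - u))].  Hence the minimax risk is
    at least [1 - exp lam / m - exp (c - th lam)] ([ms_minimax_risk_ge]).

    When [n t^2 = 2 r' log p] with [r' < 1], choosing [lam] between
    [r' log p] and [log p], and [th] small, makes both error terms vanish
    ([near_tilt_budget]).  For [s = 1] one has [r' = r < 1].  For [s >= 2] the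
    strong entries may be as large as desired: [B = sqrt (2 r)] makes
    [t = a / B] correspond to [r' = 1/2] for every [r]. *)

(** * Gaussian integrals on the line *)

Section density.
Context {d : measure_display} {T : measurableType d} {R : realType}.

(** The density is transported to the Radon-Nikodym derivative, for which the
    change of variables is known; both agree almost everywhere because they
    have the same integral over every measurable set. *)
Lemma ge0_integral_density (nu : {finite_measure set T -> \bar R})
    (mu : {sigma_finite_measure set T -> \bar R}) (f : T -> R)
    (g : T -> \bar R) :
  measurable_fun setT f -> (forall x, 0 <= f x) ->
  (forall A, measurable A -> nu A = (\int[mu]_(x in A) (f x)%:E)%E) ->
  measurable_fun setT g -> (forall x, 0 <= g x)%E ->
  (\int[nu]_x g x = \int[mu]_x (g x * (f x)%:E))%E.
Proof.
move=> mf f0 nuE mg g0.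
have numu : nu `<< mu.
  apply/null_content_dominatesP => A mA muA0; rewrite nuE//.
  by apply: null_set_integral => //; apply/measurable_funTS/measurable_EFinP.
rewrite -(Radon_Nikodym_SigmaFinite.change_of_variables numu)//.
apply: ae_eq_integral => //.
- apply: emeasurable_funM => //; apply: (measurable_int mu).
  exact: Radon_Nikodym_SigmaFinite.f_integrable.
- by apply: emeasurable_funM => //; exact/measurable_EFinP.
- apply: ae_eqe_mul2l; apply: integral_ae_eq => //.
  + exact: Radon_Nikodym_SigmaFinite.f_integrable.
  + exact/measurable_EFinP.
  + by move=> A _ mA; rewrite -nuE// -Radon_Nikodym_SigmaFinite.f_integral.
Qed.

End density.

Section gauss.
Variable R : realType.
Local Notation leb := (@lebesgue_measure R).
Local Notation gamma := (@std_normal R).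

Lemma ge0_integral_std_normal (f : R -> \bar R) :
  measurable_fun setT f -> (forall x, 0 <= f x)%E ->
  (\int[gamma]_x f x = \int[leb]_x (f x * (normal_pdf 0 1 x)%:E))%E.
Proof.
move=> mf f0; rewrite ge0_integral_distribution//=.
rewrite (@ge0_integral_density _ _ _ _ leb (normal_pdf 0 1))//.
exact: measurable_normal_pdf.
exact: normal_pdf_ge0.
Qed.

(** Lebesgue measure is determined by its values on half-open intervals, whose
    length a translation preserves. *)
Lemma lebesgue_measure_shift (h : R) (A : set R) : measurable A ->
  pushforward leb (fun x => x + h : measurableTypeR R) A = leb A.
Proof.
move=> mA; apply/esym/lebesgue_measure_unique => //=.
  exact: (@measurable_funD _ _ R).
move=> _ _ [[a b]] _ <-.
rewrite /pushforward (_ : _ @^-1` _ = `]a - h, b - h]%classic); last first.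
  by apply/seteqP; split => x /=; rewrite !in_itv/= ltrBlDr lerBrDr.
by rewrite !lebesgue_measure_itv/= !lte_fin ltrD2r -!EFinD opprB addrA subrK.
Qed.

Lemma ge0_integral_lebesgue_shift (f : R -> \bar R) (h : R) :
  measurable_fun setT f -> (forall x, 0 <= f x)%E ->
  (\int[leb]_x f (x + h)%R = \int[leb]_x f x)%E.
Proof.
move=> mf f0.
have mh : measurable_fun setT
    (fun x : measurableTypeR R => x + h : measurableTypeR R).
  exact: (@measurable_funD _ _ R).
have := @ge0_integral_pushforward _ _ (measurableTypeR R) (measurableTypeR R) R
  _ mh leb setT f measurableT mf (fun x _ => f0 x).
rewrite preimage_setT => <-.
by apply: eq_measure_integral => A mA _; exact: lebesgue_measure_shift.
Qed.

Lemma std_normal_pdf_shift (x h : R) :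
  normal_pdf 0 1 (x - h) = expR (h * x - h ^+ 2 / 2) * normal_pdf 0 1 x.
Proof.
rewrite normal_pdfE ?oner_eq0// mulrCA -expRD; congr (_ * expR _).
by rewrite subr0 expr1n; field.
Qed.

(** The integrand times the standard density is [s] times the centred normal
    density of standard deviation [s = (1 - u)^(-1/2)], so the integral is
    exactly [s]; the exponential form of the bound multiplies well over
    coordinates. *)
Lemma std_normal_sq_exp_moment (u : R) : 0 <= u < 1 ->
  (\int[gamma]_x (expR (u * x ^+ 2 / 2))%:E <= (expR (u / (1 - u) / 2))%:E)%E.
Proof.
move=> /andP[u0 u1].
have v0 : 0 < 1 - u by rewrite subr_gt0.
pose s := (Num.sqrt (1 - u))^-1.
have s0 : 0 < s by rewrite invr_gt0 sqrtr_gt0.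
have s2 : s ^+ 2 = (1 - u)^-1 by rewrite exprVn sqr_sqrtr// ltW.
have sn0 : s != 0 by rewrite gt_eqF.
have mexp : measurable_fun setT (fun x : R => expR (u * x ^+ 2 / 2)).
  apply: measurableT_comp => //; apply: measurable_funM => //.
  by apply: measurable_funM => //; exact: measurable_funX.
rewrite ge0_integral_std_normal//; last first.
  exact/measurable_EFinP.
have pk : normal_peak 1 = s * normal_peak s.
  have npE (t : R) : 0 < t -> normal_peak t = t^-1 * (Num.sqrt (pi *+ 2))^-1.
    move=> t0; rewrite /normal_peak -mulrnAr sqrtrM ?sqr_ge0// sqrtr_sqr.
    by rewrite gtr0_norm// invfM.
  by rewrite !npE// mulrA divff// invr1.
under eq_integral => x _.
  rewrite -EFinM (_ : _ * _ = s * normal_pdf 0 s x); last first.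
    rewrite !normal_pdfE ?oner_eq0// pk [expR _ * _]mulrC -!mulrA.
    congr (_ * (_ * _)); rewrite -expRD; congr expR.
    by rewrite !subr0 s2 expr1n; field; rewrite gt_eqF.
  rewrite EFinM.
  over.
have mpdf : measurable_fun setT (EFin \o normal_pdf 0 s : R -> \bar R).
  by apply/measurable_EFinP; exact: measurable_normal_pdf.
rewrite ge0_integralZl ?lee_fin ?(ltW s0)//; last first.
  by move=> x _; rewrite lee_fin normal_pdf_ge0.
rewrite integral_normal_pdf mule1 lee_fin.
rewrite -ler_sqr ?nnegrE ?expR_ge0 ?(ltW s0)// s2 -expRM_natr.
rewrite (_ : _ * 2%:R = u / (1 - u)); last by field; rewrite gt_eqF.
apply: le_trans (expR_ge1Dx _); rewrite le_eqVlt; apply/orP; left.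
by apply/eqP; field; rewrite gt_eqF.
Qed.

End gauss.

(** * Changes of measure on product spaces *)

Section image_density.
Local Open Scope ereal_scope.
Context {R : realType}.

(** [expR \o l] is the density of the image of [P] under [phi] with respect to
    [P] itself.  Stated through integrals, the property passes to products by
    Fubini without any discussion of image measures. *)
Definition image_density {d} {T : measurableType d} (P : probability T R)
    (phi : T -> T) (l : T -> R) :=
  forall f : T -> \bar R, measurable_fun setT f -> (forall x, 0 <= f x) ->
  \int[P]_x f (phi x) = \int[P]_x (f x * (expR (l x))%:E).

(** The Cameron-Martin formula in dimension one. *)
Lemma image_density_std_normal (h : R) :
  image_density (@std_normal R) (fun z => z + h)%R
    (fun z => h * z - h ^+ 2 / 2)%R.
Proof.
move=> f mf f0.
have mh : measurable_fun setT (fun z : R => z + h)%R by exact: measurable_funD.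
have ml : measurable_fun setT (fun z : R => (expR (h * z - h ^+ 2 / 2))%:E).
  apply/measurable_EFinP; apply: measurableT_comp => //.
  by apply: measurable_funB => //; exact: measurable_funM.
rewrite ge0_integral_std_normal//; last exact: measurableT_comp.
rewrite ge0_integral_std_normal//; last 2 first.
- exact: emeasurable_funM.
- by move=> x; rewrite mule_ge0// lee_fin expR_ge0.
rewrite -[RHS](@ge0_integral_lebesgue_shift _ _ h)//; last 2 first.
- apply: emeasurable_funM; first exact: emeasurable_funM.
  by apply/measurable_EFinP; exact: measurable_normal_pdf.
- move=> x; rewrite !mule_ge0// lee_fin ?expR_ge0//.
  exact: normal_pdf_ge0.
apply: eq_integral => x _.
by rewrite -muleA -EFinM -std_normal_pdf_shift addrK.
Qed.

Section pairs.
Context {d1 d2} {T1 : measurableType d1} {T2 : measurableType d2}.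
Variables (P1 : probability T1 R) (P2 : probability T2 R).

(** A change of measure of one coordinate that may depend on the other
    coordinate is a change of measure of the pair: integrate over the
    transformed coordinate first. *)
Lemma image_density_fst (phi : T1 -> T2 -> T1) (l : T1 -> T2 -> R) :
  measurable_fun setT (fun w : T1 * T2 => phi w.1 w.2) ->
  measurable_fun setT (fun w : T1 * T2 => l w.1 w.2) ->
  (forall y, image_density P1 (phi^~ y) (l^~ y)) ->
  image_density (P1 \x P2) (fun w => (phi w.1 w.2, w.2)) (fun w => l w.1 w.2).
Proof.
move=> mphi ml H f mf f0.
have m1 : measurable_fun setT (fun w : T1 * T2 => f (phi w.1 w.2, w.2)).
  apply: (measurableT_comp mf).
  by apply: measurable_fun_pair => //; exact: measurable_snd.
have m2 : measurable_fun setT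
    (fun w : T1 * T2 => f w * (expR (l w.1 w.2))%:E).
  apply: emeasurable_funM => //.
  by apply/measurable_EFinP; exact: measurableT_comp.
have g0 (w : T1 * T2) : 0 <= f w * (expR (l w.1 w.2))%:E.
  by rewrite mule_ge0// lee_fin expR_ge0.
rewrite (fubini_tonelli2 _ m1)// (fubini_tonelli2 _ m2)//.
apply: eq_integral => y _.
rewrite /fubini_G/= (H y (fun x => f (x, y)))//.
exact: measurableT_comp.
Qed.

Lemma image_density_snd (phi : T1 -> T2 -> T2) (l : T1 -> T2 -> R) :
  measurable_fun setT (fun w : T1 * T2 => phi w.1 w.2) ->
  measurable_fun setT (fun w : T1 * T2 => l w.1 w.2) ->
  (forall x, image_density P2 (phi x) (l x)) ->
  image_density (P1 \x P2) (fun w => (w.1, phi w.1 w.2)) (fun w => l w.1 w.2).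
Proof.
move=> mphi ml H f mf f0.
have m1 : measurable_fun setT (fun w : T1 * T2 => f (w.1, phi w.1 w.2)).
  apply: (measurableT_comp mf).
  by apply: measurable_fun_pair => //; exact: measurable_fst.
have m2 : measurable_fun setT
    (fun w : T1 * T2 => f w * (expR (l w.1 w.2))%:E).
  apply: emeasurable_funM => //.
  by apply/measurable_EFinP; exact: measurableT_comp.
have g0 (w : T1 * T2) : 0 <= f w * (expR (l w.1 w.2))%:E.
  by rewrite mule_ge0// lee_fin expR_ge0.
rewrite (fubini_tonelli1 _ m1)// (fubini_tonelli1 _ m2)//.
apply: eq_integral => x _.
rewrite /fubini_F/= (H x (fun y => f (x, y)))//.
exact: measurableT_comp.
Qed.

End pairs.

Section iid.
Context {d} {T : measurableType d}.
Variable P : probability T R.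

Lemma ge0_integral_iid_lawS n (f : n.+1.-tuple T -> \bar R) :
  measurable_fun setT f -> (forall t, 0 <= f t) ->
  \int[iid_law P n.+1]_t f t =
  \int[P]_x \int[iid_law P n]_t f (cons_pair (x, t)).
Proof.
move=> mf f0; rewrite /= ge0_integral_distribution//.
rewrite fubini_tonelli1//=; apply: (measurableT_comp mf).
exact: measurable_cons_pair.
Qed.

Lemma measurable_iid_sum n (l : 'I_n -> T -> R) :
  (forall i, measurable_fun setT (l i)) ->
  measurable_fun setT (fun t : n.-tuple T => \sum_i l i (tnth t i))%R.
Proof.
move=> ml; apply: measurable_sum => i.
by apply: measurableT_comp => //; exact: measurable_tnth.
Qed.

Lemma measurable_mktuple n (phi : 'I_n -> T -> T) :
  (forall i, measurable_fun setT (phi i)) ->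
  measurable_fun setT
    (fun t : n.-tuple T => [tuple phi i (tnth t i) | i < n]).
Proof.
move=> mphi; apply/measurable_fun_tnthP => i.
rewrite (_ : _ \o _ = phi i \o (@tnth _ T ^~ i)); last first.
  by apply/funext => t /=; rewrite tnth_mktuple.
by apply: measurableT_comp => //; exact: measurable_tnth.
Qed.

(** The maps may vary with the index: this is what allows the noise
    coordinates to be translated by the different entries of a column of the
    design. *)
Lemma image_density_iid n (phi : 'I_n -> T -> T) (l : 'I_n -> T -> R) :
  (forall i, measurable_fun setT (phi i)) ->
  (forall i, measurable_fun setT (l i)) ->
  (forall i, image_density P (phi i) (l i)) ->
  image_density (iid_law P n)
    (fun t => [tuple phi i (tnth t i) | i < n])
    (fun t => \sum_i l i (tnth t i))%R.
Proof.
elim: n phi l => [|n IHn] phi l mphi ml H f mf f0.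
  apply: eq_integral => t _; rewrite big_ord0 expR0 mule1.
  by congr f; apply: eq_from_tnth => -[].
have mcons : measurable_fun setT (@cons_pair _ T n).
  exact: measurable_cons_pair.
have mS := measurable_mktuple mphi.
have ml' : measurable_fun setT
    (fun t : n.+1.-tuple T => f t * (expR (\sum_i l i (tnth t i)))%:E).
  apply: emeasurable_funM => //; apply/measurable_EFinP/measurableT_comp => //.
  exact: measurable_iid_sum.
rewrite ge0_integral_iid_lawS//; last exact: measurableT_comp.
rewrite ge0_integral_iid_lawS//; last first.
  by move=> t; rewrite mule_ge0// lee_fin expR_ge0.
pose l' (t : n.-tuple T) := (\sum_(i < n) l (lift ord0 i) (tnth t i))%R.
have ml2 : measurable_fun setT l'.
  by apply: (measurable_iid_sum (l := fun i => l (lift ord0 i))).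
pose G x := \int[iid_law P n]_t (f (cons_pair (x, t)) * (expR (l' t))%:E).
have mg : measurable_fun setT
    (fun w : T * n.-tuple T => f (cons_pair w) * (expR (l' w.2))%:E).
  apply: emeasurable_funM; first exact: measurableT_comp.
  apply/measurable_EFinP/measurableT_comp => //.
  by apply: (measurableT_comp ml2); exact: measurable_snd.
have g0 w : 0 <= f (cons_pair w) * (expR (l' w.2))%:E.
  by rewrite mule_ge0// lee_fin expR_ge0.
have mG : measurable_fun setT G.
  exact: (measurable_fun_fubini_tonelli_F _ mg g0).
transitivity (\int[P]_x G (phi ord0 x)).
  apply: eq_integral => x _.
  rewrite /G -(IHn (fun i => phi (lift ord0 i)) (fun i => l (lift ord0 i)) _ _ _
    (fun t => f (cons_pair (phi ord0 x, t))))//.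
  - apply: eq_integral => t _; congr f; apply: eq_from_tnth => i.
    rewrite tnth_mktuple; case: (unliftP ord0 i) => [j|] ->.
      by rewrite !tnthS tnth_mktuple.
    by [].
  - by apply: measurableT_comp => //; exact: measurableT_comp.
rewrite H//; last by move=> x; apply: integral_ge0 => t _; exact: (g0 (x, t)).
apply: eq_integral => x _.
have mgx : measurable_fun setT
    (fun t : n.-tuple T => f (cons_pair (x, t)) * (expR (l' t))%:E).
  exact: (measurableT_comp mg).
rewrite /G -ge0_integralZr ?lee_fin ?expR_ge0//.
apply: eq_integral => t _; rewrite -muleA -EFinM -expRD.
congr (_ * (expR _)%:E); rewrite big_ord_recl addrC; congr (_ + _)%R.
by apply: eq_bigr => i _; rewrite tnthS.
Qed.

Lemma le_integral_iid_expR n (g : 'I_n -> T -> R) (c : 'I_n -> R) :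
  (forall i, measurable_fun setT (g i)) ->
  (forall i, \int[P]_x (expR (g i x))%:E <= (expR (c i))%:E) ->
  \int[iid_law P n]_t (expR (\sum_i g i (tnth t i)))%:E <=
  (expR (\sum_i c i))%:E.
Proof.
elim: n g c => [|n IHn] g c mg H.
  under eq_integral do rewrite big_ord0.
  by rewrite big_ord0 integral_cst//= probability_setT mule1.
rewrite ge0_integral_iid_lawS//; last first.
  by apply/measurable_EFinP/measurableT_comp => //; exact: measurable_iid_sum.
pose g' (t : n.-tuple T) := (\sum_(i < n) g (lift ord0 i) (tnth t i))%R.
have mg' : measurable_fun setT g'.
  by apply: (measurable_iid_sum (l := fun i => g (lift ord0 i))).
have mE : measurable_fun setT (fun t => (expR (g' t))%:E).
  by apply/measurable_EFinP/measurableT_comp.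
have mE0 : measurable_fun setT (fun x => (expR (g ord0 x))%:E).
  by apply/measurable_EFinP/measurableT_comp.
rewrite (eq_integral (fun x => (expR (g ord0 x))%:E *
    \int[iid_law P n]_t (expR (g' t))%:E)); last first.
  move=> x _; rewrite -ge0_integralZl//.
  apply: eq_integral => t _; rewrite -EFinM -expRD big_ord_recl.
  by congr (expR (_ + _))%:E; apply: eq_bigr => i _; rewrite tnthS.
rewrite ge0_integralZr//; last first.
  by apply: integral_ge0 => t _; rewrite lee_fin expR_ge0.
rewrite big_ord_recl expRD EFinM; apply: lee_pmul => //.
- by apply: integral_ge0 => t _; rewrite lee_fin expR_ge0.
- by apply: integral_ge0 => t _; rewrite lee_fin expR_ge0.
- exact: (IHn (fun i => g (lift ord0 i)) (fun i => c (lift ord0 i))).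
Qed.

End iid.
End image_density.

(** * Disjoint events under Gaussian translations *)

Lemma integral_cst_probability {d} {T : measurableType d} {R : realType}
    (P : probability T R) (c : \bar R) : (\int[P]_x c = c)%E.
Proof. by rewrite integral_cst//= probability_setT mule1. Qed.

Section testing.
Local Open Scope ereal_scope.
Context {d} {W : measurableType d} {R : realType}.
Variable Q : probability W R.

Lemma sum_probability_disjoint_le1 {I : finType} (S : {set I})
    (D : I -> set W) :
  (forall j, measurable (D j)) ->
  (forall i j, i \in S -> j \in S -> i != j -> D i `&` D j = set0) ->
  \sum_(j in S) Q (D j) <= 1.
Proof.
move=> mD dD.
have tD : trivIset [set` enum S] D.
  move=> i j /= iS jS [w Dw]; apply/eqP/negPn/negP => ij.
  rewrite !mem_enum in iS jS.
  by have := dD i j iS jS ij => DE; rewrite DE in Dw.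
have mU : measurable (\big[setU/set0]_(i <- enum S) D i).
  by apply: bigsetU_measurable.
have := @ge0_integral_bigsetU _ _ _ Q _ D (cst 1) (enum S) mD (enum_uniq _) tD
  (@measurable_cst _ _ _ _ _ _) (fun _ _ => lee01).
rewrite integral_cst// mul1e.
rewrite (eq_bigr (fun j => Q (D j))); last first.
  by move=> j _; rewrite (integral_cst _ (mD j)) mul1e.
by rewrite -big_enum/= => <-; exact: probability_le1.
Qed.

(** [phi t] behaves like the translation [Z + t x] of a standard Gaussian vector
    [Z] by an independent vector [x], with [U = <x, Z>] and [V = |x|^2]. *)
Definition gaussian_tilt (phi : R -> W -> W) (U V : W -> R) :=
  forall t : R,
    image_density Q (phi t) (fun w => t * U w - t ^+ 2 * V w / 2)%R /\
    forall w, V (phi t w) = V w.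

(** The [b]-th power of the likelihood ratio of parameter [t] is the likelihood
    ratio of parameter [b t] times a function of [V]; the latter is invariant
    under the translation, so the change of measure can be undone. *)
Lemma gaussian_tilt_moment phi U V : measurable_fun setT V ->
  gaussian_tilt phi U V -> forall t b : R,
  \int[Q]_w (expR (b * (t * U w - t ^+ 2 * V w / 2)))%:E =
  \int[Q]_w (expR (b * (b - 1) * t ^+ 2 * V w / 2))%:E.
Proof.
move=> mV H t b.
have [Hd HV] := H (b * t)%R.
have mF : measurable_fun setT
    (fun w => (expR (b * (b - 1) * t ^+ 2 * V w / 2))%:E).
  apply/measurable_EFinP/measurableT_comp => //.
  by apply: measurable_funM => //; exact: measurable_funM.
have := Hd _ mF (fun w => ltac:(by rewrite lee_fin expR_ge0)).
under eq_integral do rewrite HV.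
move=> ->; apply: eq_integral => w _.
by rewrite -EFinM -expRD; congr (expR _)%:E; field.
Qed.

(** Each [phi j t] has likelihood ratio [expR l_j].  Where [l_j <= lam] the ratio
    is at most [expR lam], and disjointness bounds the total by [expR lam];
    where [l_j > lam] it is at most [expR ((1 + th) * l_j - th * lam)], which is
    integrated over the whole space. *)
Lemma sum_tilted_disjoint_le {I : finType} (S : {set I}) (D : I -> set W)
    (phi : I -> R -> W -> W) (U V : I -> W -> R) (t th lam c : R) :
  (forall j, measurable (D j)) ->
  (forall i j, i \in S -> j \in S -> i != j -> D i `&` D j = set0) ->
  (forall j, measurable_fun setT (U j)) ->
  (forall j, measurable_fun setT (V j)) ->
  (forall j, j \in S -> gaussian_tilt (phi j) (U j) (V j)) ->
  (forall j, j \in S -> measurable (phi j t @^-1` D j)) ->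
  (0 <= th)%R ->
  (forall j, j \in S ->
    \int[Q]_w (expR (th * (1 + th) * t ^+ 2 * V j w / 2))%:E <= (expR c)%:E) ->
  \sum_(j in S) Q (phi j t @^-1` D j) <=
  (expR lam + #|S|%:R * expR (c - th * lam))%:E.
Proof.
move=> mD dD mU mV H mp th0 Hc.
pose l j w := (t * U j w - t ^+ 2 * V j w / 2)%R.
have ml j : measurable_fun setT (l j).
  apply: measurable_funB; first exact: measurable_funM.
  by apply: measurable_funM => //; exact: measurable_funM.
have one j : j \in S -> Q (phi j t @^-1` D j) <=
    (expR lam)%:E * Q (D j) + (expR (c - th * lam))%:E.
  move=> jS; have [Hd _] := H j jS t.
  have mI : measurable_fun setT (fun w => (\1_(D j) w)%:E : \bar R).
    by apply/measurable_EFinP; exact: measurable_indic.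
  have me k : measurable_fun setT (fun w => (expR (k * l j w))%:E).
    by apply/measurable_EFinP/measurableT_comp => //; exact: measurable_funM.
  have -> : Q (phi j t @^-1` D j) = \int[Q]_w (\1_(D j) (phi j t w))%:E.
    by rewrite -[X in Q X]setIT -integral_indic//; exact: mp.
  rewrite (Hd (fun w => (\1_(D j) w)%:E))//.
  apply: (@le_trans _ _ (\int[Q]_w ((expR lam)%:E * (\1_(D j) w)%:E +
      (expR (- (th * lam)))%:E * (expR ((1 + th) * l j w))%:E))).
    apply: ge0_le_integral => //.
    - apply: emeasurable_funM => //.
      by apply/measurable_EFinP/measurableT_comp => //; exact: ml.
    - by apply: emeasurable_funD; exact: emeasurable_funM.
    - move=> w _; rewrite -!EFinM -EFinD lee_fin.
      rewrite indicE; case: (w \in D j); rewrite ?(mul1r, mul0r, mulr1, mulr0).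
        rewrite -expRD; have [lw|lw] := leP (l j w) lam.
          by rewrite -[leLHS]addr0 lerD ?ler_expR ?expR_ge0.
        rewrite -[leLHS]add0r lerD ?ler_expR ?expR_ge0//.
        rewrite -/(l j w); move: lw; move: (l j w) => x lw.
        by nra.
      by rewrite add0r mulr_ge0 ?expR_ge0.
  rewrite ge0_integralD//; last 2 first.
  - exact: emeasurable_funM.
  - exact: emeasurable_funM.
  rewrite !ge0_integralZl ?lee_fin ?expR_ge0//.
  rewrite integral_indic// setIT; apply: leeD => //.
  rewrite [(c - _)%R]addrC expRD EFinM; apply: lee_pmul => //.
    by apply: integral_ge0 => w _; rewrite lee_fin expR_ge0.
  rewrite /l (gaussian_tilt_moment (mV j) (H j jS)).
  rewrite [X in (X * t ^+ 2)%R](_ : _ = th * (1 + th))%R ?Hc//.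
  by rewrite [(1 + th)%R]addrC addrK mulrC.
apply: (@le_trans _ _ (\sum_(j in S)
  ((expR lam)%:E * Q (D j) + (expR (c - th * lam))%:E))).
  exact: lee_sum.
rewrite big_split/= -ge0_sume_distrr//.
rewrite EFinD; apply: leeD.
  rewrite -[leRHS]mule1; apply: lee_pmul => //.
  - by rewrite sume_ge0.
  - exact: sum_probability_disjoint_le1.
by rewrite sumEFin sumr_const mulr_natl.
Qed.

End testing.

(** * Absorbing a column into the noise or into the first column *)

Section tilts.
Variable R : realType.
Local Notation gamma := (@std_normal R).

Definition col_sqnorm n p (j : 'I_p) (w : design R n p * n.-tuple R) : R :=
  \sum_(i < n) tnth (tnth w.1 i) j ^+ 2.

Definition col_dot_noise n p (j : 'I_p) (w : design R n p * n.-tuple R) : R :=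
  \sum_(i < n) tnth (tnth w.1 i) j * tnth w.2 i.

Definition col_dot_head n p (j : 'I_p.+1) (w : design R n p.+1 * n.-tuple R) :
    R :=
  \sum_(i < n) tnth (tnth w.1 i) j * tnth (tnth w.1 i) ord0.

Definition shift_noise n p (j : 'I_p) (t : R)
    (w : design R n p * n.-tuple R) : design R n p * n.-tuple R :=
  (w.1, [tuple tnth w.2 i + t * tnth (tnth w.1 i) j | i < n]).

(** The translation of the design that absorbs a multiple of column [j] into
    column 0, one row at a time. *)
Definition shift_row_head p (j : 'I_p.+1) (t : R) (x : p.+1.-tuple R) :
    p.+1.-tuple R :=
  [tuple tnth x k + (if k == ord0 then t * tnth x j else 0) | k < p.+1].

Definition shift_head n p (j : 'I_p.+1) (t : R)
    (w : design R n p.+1 * n.-tuple R) : design R n p.+1 * n.-tuple R :=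
  ([tuple shift_row_head j t (tnth w.1 i) | i < n], w.2).

Lemma measurable_entry n p (i : 'I_n) (j : 'I_p) :
  measurable_fun setT
    (fun w : design R n p * n.-tuple R => tnth (tnth w.1 i) j).
Proof.
apply: (measurableT_comp (@measurable_tnth _ _ p j)).
apply: (measurableT_comp (@measurable_tnth _ (p.-tuple R) n i)).
exact: measurable_fst.
Qed.

Lemma measurable_noise n p (i : 'I_n) :
  measurable_fun setT (fun w : design R n p * n.-tuple R => tnth w.2 i).
Proof.
apply: (measurableT_comp (@measurable_tnth _ R n i)); exact: measurable_snd.
Qed.

Lemma measurable_col_sqnorm n p (j : 'I_p) :
  measurable_fun setT (@col_sqnorm n p j).
Proof.
by apply: measurable_sum => i; apply: measurable_funX; exact: measurable_entry.
Qed.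

Lemma measurable_col_dot_noise n p (j : 'I_p) :
  measurable_fun setT (@col_dot_noise n p j).
Proof.
apply: measurable_sum => i; apply: measurable_funM.
  exact: measurable_entry.
exact: measurable_noise.
Qed.

Lemma measurable_col_dot_head n p (j : 'I_p.+1) :
  measurable_fun setT (@col_dot_head n p j).
Proof.
by apply: measurable_sum => i; apply: measurable_funM; exact: measurable_entry.
Qed.

Lemma measurable_shift_noise n p (j : 'I_p) (t : R) :
  measurable_fun setT (@shift_noise n p j t).
Proof.
apply: measurable_fun_pair; first exact: measurable_fst.
apply/measurable_fun_tnthP => i.
rewrite (_ : _ \o _ = fun w : design R n p * n.-tuple R =>
    tnth w.2 i + t * tnth (tnth w.1 i) j); last first.
  by apply/funext => w /=; rewrite tnth_mktuple.
apply: measurable_funD; first exact: measurable_noise.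
by apply: measurable_funM => //; exact: measurable_entry.
Qed.

Lemma measurable_shift_row_head p (j : 'I_p.+1) (t : R) :
  measurable_fun setT (@shift_row_head p j t).
Proof.
apply/measurable_fun_tnthP => k.
rewrite (_ : _ \o _ = fun x : p.+1.-tuple R =>
    tnth x k + (if k == ord0 then t * tnth x j else 0)); last first.
  by apply/funext => w /=; rewrite tnth_mktuple.
apply: measurable_funD; first exact: measurable_tnth.
have [_|_] := eqVneq k ord0; last exact: measurable_cst.
by apply: measurable_funM => //; exact: measurable_tnth.
Qed.

Lemma measurable_shift_head n p (j : 'I_p.+1) (t : R) :
  measurable_fun setT (@shift_head n p j t).
Proof.
apply: measurable_fun_pair; last exact: measurable_snd.
have := @measurable_mktuple _ (p.+1.-tuple R) n (fun=> shift_row_head j t)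
  (fun=> measurable_shift_row_head j t).
by move=> m; apply: (measurableT_comp m); exact: measurable_fst.
Qed.

Lemma sum_tilt_exponent n (t : R) (u v : 'I_n -> R) :
  \sum_i (t * u i - t ^+ 2 * v i / 2) =
  t * (\sum_i u i) - t ^+ 2 * (\sum_i v i) / 2.
Proof. by rewrite sumrB -mulr_suml -!mulr_sumr. Qed.

(** Conditionally on the design, the noise coordinates are independent standard
    normals translated by constants. *)
Lemma gaussian_tilt_noise n p (j : 'I_p) :
  gaussian_tilt (design_noise_law R n p) (shift_noise j) (col_dot_noise j)
    (col_sqnorm j).
Proof.
move=> t; split=> //.
have H (X : design R n p) : image_density (iid_law gamma n)
    (fun e => [tuple tnth e i + t * tnth (tnth X i) j | i < n])
    (fun e => t * col_dot_noise j (X, e) - t ^+ 2 * col_sqnorm j (X, e) / 2).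
  have := @image_density_iid R _ R gamma n
    (fun i z => z + t * tnth (tnth X i) j)
    (fun i z => (t * tnth (tnth X i) j) * z - (t * tnth (tnth X i) j) ^+ 2 / 2)
    (fun i => ltac:(exact: measurable_funD)) _
    (fun i => image_density_std_normal _).
  rewrite (_ : (fun e => _) = (fun e : n.-tuple R => t * col_dot_noise j (X, e) -
      t ^+ 2 * col_sqnorm j (X, e) / 2)); last first.
    apply/funext => e; rewrite /= -sum_tilt_exponent; apply: eq_bigr => i _.
    by rewrite /= mulrA exprMn.
  apply => i; apply: measurable_funB => //; exact: measurable_funM.
have mU := @measurable_col_dot_noise n p j.
have mV := @measurable_col_sqnorm n p j.
apply: (image_density_snd (iid_law (iid_law gamma p) n)
  (phi := fun X e => (shift_noise j t (X, e)).2)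
  (l := fun X e => t * col_dot_noise j (X, e) - t ^+ 2 * col_sqnorm j (X, e) / 2)
  _ _ H).
- rewrite (_ : (fun w => _) = snd \o shift_noise j t); last first.
    by apply/funext => -[].
  by apply: measurableT_comp => //; exact: measurable_shift_noise.
- rewrite (_ : (fun w => _) = (fun w : design R n p * n.-tuple R =>
      t * col_dot_noise j w - t ^+ 2 * col_sqnorm j w / 2)); last first.
    by apply/funext => -[].
  apply: measurable_funB; first exact: measurable_funM.
  by apply: measurable_funM => //; exact: measurable_funM.
Qed.

(** Since [j != ord0], the translation of the head only depends on the tail of
    the row, which is independent of the head. *)
Lemma image_density_shift_row_head p (j : 'I_p.+1) (t : R) : j != ord0 ->
  image_density (iid_law gamma p.+1) (shift_row_head j t)
    (fun x => t * (tnth x j * tnth x ord0) - t ^+ 2 * tnth x j ^+ 2 / 2).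
Proof.
case: (unliftP ord0 j) => [k ->|->]; last by rewrite eqxx.
move=> _ f mf f0.
have mcons : measurable_fun setT (@cons_pair _ R p).
  exact: measurable_cons_pair.
have mk : measurable_fun setT (fun w : R * p.-tuple R => tnth w.2 k).
  by apply: (measurableT_comp (@measurable_tnth _ R p k)); exact: measurable_snd.
have m1 : measurable_fun setT (fun w : R * p.-tuple R => w.1).
  exact: measurable_fst.
have mp := measurable_shift_row_head (lift ord0 k) t.
have ml : measurable_fun setT (fun x : p.+1.-tuple R =>
    t * (tnth x (lift ord0 k) * tnth x ord0) -
    t ^+ 2 * tnth x (lift ord0 k) ^+ 2 / 2).
  have mt i : measurable_fun setT (fun x : p.+1.-tuple R => tnth x i).
    exact: measurable_tnth.
  apply: measurable_funB.
    by apply: measurable_funM => //; exact: measurable_funM.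
  apply: measurable_funM => //; apply: measurable_funM => //.
  exact: measurable_funX.
rewrite [LHS]ge0_integral_distribution//; last exact: measurableT_comp.
rewrite [RHS]ge0_integral_distribution//; last 2 first.
- by apply: emeasurable_funM => //; apply/measurable_EFinP/measurableT_comp.
- by move=> x; rewrite mule_ge0// lee_fin expR_ge0.
have := @image_density_fst R _ _ R (p.-tuple R) gamma (iid_law gamma p)
  (fun z x => z + t * tnth x k)
  (fun z x => (t * tnth x k) * z - (t * tnth x k) ^+ 2 / 2) _ _
  (fun x => image_density_std_normal _).
move=> /(_ _ _ (f \o cons_pair (n := p)) _ _) H.
transitivity (\int[(gamma \x iid_law gamma p)%E]_w
    (f \o cons_pair (n := p)) ((w.1 + t * tnth w.2 k)%R, w.2))%E.
  apply: eq_integral => -[z x] _ /=; congr f; apply: eq_from_tnth => i.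
  rewrite tnth_mktuple; case: (unliftP ord0 i) => [i' ->|->].
    by rewrite !tnthS /= addr0.
  by rewrite eqxx tnthS.
have mz : measurable_fun setT (fun w : R * p.-tuple R => w.1 + t * tnth w.2 k).
  by apply: measurable_funD => //; exact: measurable_funM.
have mzl : measurable_fun setT (fun w : R * p.-tuple R =>
    t * tnth w.2 k * w.1 - (t * tnth w.2 k) ^+ 2 / 2).
  apply: measurable_funB.
    by apply: measurable_funM => //; exact: measurable_funM.
  by apply: measurable_funM => //; apply: measurable_funX; exact: measurable_funM.
rewrite (H mz mzl (measurableT_comp mf mcons) (fun=> f0 _)).
apply: eq_integral => -[z x] _ /=; rewrite tnthS.
by congr (_ * (expR _)%:E)%E; rewrite exprMn mulrA.
Qed.

Lemma gaussian_tilt_head n p (j : 'I_p.+1) : j != ord0 ->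
  gaussian_tilt (design_noise_law R n p.+1) (shift_head j) (col_dot_head j)
    (col_sqnorm j).
Proof.
move=> j0 t; split; last first.
  move=> w; apply: eq_bigr => i _.
  by rewrite !tnth_mktuple (negbTE j0) addr0.
have mt i : measurable_fun setT (fun x : p.+1.-tuple R => tnth x i).
  exact: measurable_tnth.
have H (e : n.-tuple R) : image_density (iid_law (iid_law gamma p.+1) n)
    (fun X => [tuple shift_row_head j t (tnth X i) | i < n])
    (fun X => t * col_dot_head j (X, e) - t ^+ 2 * col_sqnorm j (X, e) / 2).
  have := @image_density_iid R _ _ (iid_law gamma p.+1) n
    (fun=> shift_row_head j t) _ (fun=> measurable_shift_row_head j t) _
    (fun i => image_density_shift_row_head t j0).
  rewrite (_ : (fun X => _) = (fun X : design R n p.+1 =>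
     t * col_dot_head j (X, e) - t ^+ 2 * col_sqnorm j (X, e) / 2)); last first.
    by apply/funext => X; rewrite /= -sum_tilt_exponent.
  apply => _; apply: measurable_funB.
    by apply: measurable_funM => //; exact: measurable_funM.
  apply: measurable_funM => //; apply: measurable_funM => //.
  exact: measurable_funX.
have mU := @measurable_col_dot_head n p j.
have mV := @measurable_col_sqnorm n p.+1 j.
apply: (image_density_fst (iid_law gamma n)
  (phi := fun X e => (shift_head j t (X, e)).1)
  (l := fun X e => t * col_dot_head j (X, e) - t ^+ 2 * col_sqnorm j (X, e) / 2)
  _ _ H).
- rewrite (_ : (fun w => _) = fst \o shift_head j t); last first.
    by apply/funext => -[].
  by apply: measurableT_comp => //; exact: measurable_shift_head.
- rewrite (_ : (fun w => _) = (fun w : design R n p.+1 * n.-tuple R =>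
      t * col_dot_head j w - t ^+ 2 * col_sqnorm j w / 2)); last first.
    by apply/funext => -[].
  apply: measurable_funB; first exact: measurable_funM.
  by apply: measurable_funM => //; exact: measurable_funM.
Qed.

(** The integrand is a product over the rows, and in each row only coordinate
    [j] matters: the product bound [le_integral_iid_expR] is used once over the
    rows and once, with a single nonzero exponent, inside a row. *)
Lemma le_integral_expR_col_sqnorm n p (j : 'I_p) (u : R) : 0 <= u < 1 ->
  (\int[design_noise_law R n p]_w (expR (u * col_sqnorm j w / 2))%:E <=
   (expR (n%:R * (u / (1 - u) / 2)))%:E)%E.
Proof.
move=> u01.
have mV := @measurable_col_sqnorm n p j.
have mF : measurable_fun setT (fun w : design R n p * n.-tuple R =>
    (expR (u * col_sqnorm j w / 2))%:E).
  apply/measurable_EFinP/measurableT_comp => //.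
  by apply: measurable_funM => //; exact: measurable_funM.
rewrite fubini_tonelli1//.
pose g (x : p.-tuple R) := u * tnth x j ^+ 2 / 2.
have mg : measurable_fun setT g.
  apply: measurable_funM => //; apply: measurable_funM => //.
  by apply: measurable_funX; exact: measurable_tnth.
rewrite (eq_integral (fun X : design R n p =>
    (expR (\sum_i g (tnth X i)))%:E)); last first.
  move=> X _; rewrite /fubini_F.
  rewrite (eq_integral (cst (expR (\sum_i g (tnth X i)))%:E)).
    exact: (integral_cst_probability (iid_law gamma n)).
  by move=> e _; congr (expR _)%:E; rewrite -mulr_suml -mulr_sumr.
apply: (le_trans (@le_integral_iid_expR R _ _ (iid_law gamma p) n (fun=> g)
  (fun=> u / (1 - u) / 2) (fun=> mg) _)); last first.
  by rewrite sumr_const card_ord mulr_natl.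
move=> _.
pose h (k : 'I_p) (z : R) := if k == j then u * z ^+ 2 / 2 else 0.
pose c (k : 'I_p) := if k == j then u / (1 - u) / 2 else 0.
have mh k : measurable_fun setT (h k).
  rewrite /h; have [_|_] := eqVneq k j; last exact: measurable_cst.
  rewrite /=; apply: measurable_funM => //.
  by apply: measurable_funM => //; exact: measurable_funX.
have hc k : (\int[gamma]_x (expR (h k x))%:E <= (expR (c k))%:E)%E.
  rewrite /h /c; have [_|_] := eqVneq k j; first exact: std_normal_sq_exp_moment.
  by rewrite (integral_cst_probability gamma).
have := le_integral_iid_expR mh hc.
rewrite /c -big_mkcond/= big_pred1_eq; apply: le_trans.
rewrite le_eqVlt; apply/orP; left; apply/eqP.
apply: eq_integral => x _; congr (expR _)%:E.
by rewrite /h -big_mkcond/= big_pred1_eq.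
Qed.

End tilts.

(** * Spiked signals and the lower bound on the minimax risk *)

Section prior.
Variable R : realType.

Section signals.
Variables (p s : nat) (B a : R).

Definition strong_signal : p.-tuple R :=
  [tuple if (i < s.-1)%N then B else 0 | i < p].

Definition spiked_signal (j : 'I_p) : p.-tuple R :=
  [tuple if i == j then a else tnth strong_signal i | i < p].

(** The positions available to the weak coordinate. *)
Definition spike_set : {set 'I_p} := [set j : 'I_p | (s.-1 <= j)%N]%SET.

Lemma card_strong_set : (s.-1 <= p)%N ->
  #|[set j : 'I_p | (j < s.-1)%N]%SET| = s.-1.
Proof.
move=> sp; rewrite cardsE -sum1_card.
by rewrite (big_ord_narrow (F := fun _ => 1%N) sp) sum1_card card_ord.
Qed.

Lemma card_spike_set : (s.-1 <= p)%N -> #|spike_set| = (p - s.-1)%N.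
Proof.
move=> sp; have := cardsC [set j : 'I_p | (j < s.-1)%N]%SET.
rewrite card_strong_set// card_ord => pE.
have -> : spike_set = (~: [set j : 'I_p | (j < s.-1)%N])%SET.
  by apply/setP => j; rewrite !inE -leqNgt.
by rewrite -[in RHS]pE addKn.
Qed.

Lemma support_spiked_signal (j : 'I_p) : a != 0 -> B != 0 ->
  Defs.support (spiked_signal j) = (j |: [set i : 'I_p | (i < s.-1)%N])%SET.
Proof.
move=> a0 B0; apply/setP => i; rewrite !inE !tnth_mktuple.
have [_|_] := eqVneq i j; first by rewrite a0.
by case: ifP => _; rewrite ?B0 ?eqxx.
Qed.

Lemma spiked_signal_class (j : 'I_p) : (0 < s)%N -> 0 < a -> a <= B ->
  j \in spike_set -> signal_class s a (spiked_signal j).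
Proof.
rewrite inE => s0 a0 aB sj.
have B0 : 0 < B by exact: lt_le_trans aB.
have sp : (s.-1 <= p)%N by rewrite (leq_trans sj)// ltnW.
split.
  rewrite support_spiked_signal ?gt_eqF// cardsU1 inE ltnNge sj/=.
  by rewrite card_strong_set// add1n prednK.
move=> i; rewrite support_spiked_signal ?gt_eqF// !inE !tnth_mktuple.
have [_ _|_ /= ->] := eqVneq i j; first by rewrite gtr0_norm.
by rewrite gtr0_norm.
Qed.

Lemma sum_spiked_signal (j : 'I_p) (x : p.-tuple R) : j \in spike_set ->
  \sum_(i < p) tnth x i * tnth (spiked_signal j) i =
  \sum_(i < p) tnth x i * tnth strong_signal i + a * tnth x j.
Proof.
rewrite inE => sj; rewrite (bigD1 j)//= [in RHS](bigD1 j)//=.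
rewrite !tnth_mktuple eqxx ltnNge sj/= mulr0 add0r addrC mulrC.
congr (_ + _); apply: eq_bigr => i ij.
by rewrite !tnth_mktuple (negbTE ij).
Qed.

End signals.

Section leading.
Variables (n p s : nat).

(** Only the marginals at candidate positions are compared, so that the event
    ignores the columns carrying the strong coordinates, in particular the one
    that [shift_head] modifies. *)
Definition leading (j : 'I_p) : set (sample R n p) :=
  [set xy | forall i, i \in spike_set p s -> i != j ->
    `|marginal xy i| < `|marginal xy j|].

Lemma leading_disjoint (i j : 'I_p) : i \in spike_set p s ->
  j \in spike_set p s -> i != j -> leading i `&` leading j = set0.
Proof.
move=> iS jS ij; apply/seteqP; split => // xy [/= Li Lj].
have := Li j jS; rewrite eq_sym => /(_ ij) lt1.
by have := lt_trans lt1 (Lj i iS ij); rewrite ltxx.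
Qed.

Lemma measurable_marginal (j : 'I_p) :
  measurable_fun setT (fun xy : sample R n p => marginal xy j).
Proof.
apply: measurable_funM => //; apply: measurable_sum => i.
by apply: measurable_funM; [exact: measurable_entry|exact: measurable_noise].
Qed.

Lemma measurable_leading (j : 'I_p) : measurable (leading j).
Proof.
have -> : leading j = \bigcap_(i in [set` [set i in spike_set p s | i != j]%SET])
    [set xy | `|marginal xy i| < `|marginal xy j|].
  apply/seteqP; split => [xy L i /=|xy L i iS ij].
    by rewrite !inE => /andP[? ?]; apply: L => //; rewrite inE.
  by apply: L => /=; rewrite inE iS.
apply: fin_bigcap_measurable; first exact: finite_finset.
move=> i _; rewrite -[X in measurable X]setTI.
apply: (@measurable_fun_ltr _ _ _ setT
  (fun xy : sample R n p => `|marginal xy i|)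
  (fun xy => `|marginal xy j|) _ _ measurableT [set true]) => //.
- by apply: measurableT_comp => //; exact: measurable_marginal.
- by apply: measurableT_comp => //; exact: measurable_marginal.
Qed.

Lemma measurable_recovery (tau : sample R n p -> R) (A : {set 'I_p}) :
  measurable_fun setT tau ->
  measurable [set xy | marginal_screening tau xy = A].
Proof.
move=> mt.
have -> : [set xy | marginal_screening tau xy = A] =
    \bigcap_(j in [set: 'I_p])
      [set xy | (tau xy <= `|marginal xy j|) = (j \in A)].
  apply/seteqP; split => [xy /= <- j _ /=|xy H]; first by rewrite inE.
  by apply/setP => j; rewrite inE; exact: H.
apply: fin_bigcap_measurable; first exact: finite_finset.
move=> j _; rewrite -[X in measurable X]setTI.
apply: (@measurable_fun_ler _ _ _ setT tau
  (fun xy : sample R n p => `|marginal xy j|) _ _ measurableT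
  [set j \in A]) => //.
by apply: measurableT_comp => //; exact: measurable_marginal.
Qed.

Lemma error_probE (tau : sample R n p -> R) (beta : p.-tuple R) :
  measurable_fun setT tau -> error_prob tau beta =
  (1 - data_law n beta
     [set xy | marginal_screening tau xy = Defs.support beta])%E.
Proof.
move=> mtau; rewrite -probability_setC; last exact: measurable_recovery.
by congr (data_law _ _ _); apply/seteqP; split => xy /eqP.
Qed.

Lemma error_prob_le1 (tau : sample R n p -> R) (beta : p.-tuple R) :
  measurable_fun setT tau -> (error_prob tau beta <= 1)%E.
Proof. by move=> mtau; rewrite error_probE// geeDl// oppe_le0. Qed.

(** Exact recovery puts the threshold between [|mu_j|] and the null
    marginals. *)
Lemma recovery_leading (tau : sample R n p -> R) (a B : R) (j : 'I_p) xy :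
  a != 0 -> B != 0 ->
  marginal_screening tau xy = Defs.support (spiked_signal s B a j) ->
  leading j xy.
Proof.
move=> a0 B0; rewrite support_spiked_signal// => /setP H i.
rewrite inE leqNgt => iS ij.
have := H j; rewrite !inE eqxx /= => tj.
have := H i; rewrite !inE (negbTE ij) (negbTE iS) /= => /negbT.
by rewrite -ltNge => ti; exact: lt_le_trans ti tj.
Qed.

End leading.

Lemma observe_spiked_noise n p s (a B : R) (j : 'I_p)
    (w : design R n p * n.-tuple R) : j \in spike_set p s ->
  observe (spiked_signal s B a j) w =
  observe (strong_signal p s B) (shift_noise j a w).
Proof.
move=> jS; rewrite /observe/=; congr pair; apply: eq_from_tnth => i.
rewrite [LHS]tnth_mktuple [RHS]tnth_mktuple sum_spiked_signal//=.
by rewrite tnth_mktuple -addrA; congr (_ + _); rewrite addrC.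
Qed.

(** The response is the same on both sides, since
    [t * B * X_j + B * X_0 = B * (X_0 + t * X_j)], and so are the columns
    compared by [leading]. *)
Lemma leading_observe_spiked_head n p s (B t : R) (j : 'I_p.+1)
    (w : design R n p.+1 * n.-tuple R) : (1 < s)%N -> j \in spike_set p.+1 s ->
  leading s j (observe (spiked_signal s B (t * B) j) w) ->
  leading s j (observe (strong_signal p.+1 s B) (shift_head j t w)).
Proof.
move=> s1 jS.
have S0 i : i \in spike_set p.+1 s -> i != ord0.
  rewrite inE => si; apply/eqP => i0.
  by move: si; rewrite i0 leqn0 -subn1 subn_eq0 leqNgt s1.
have E i : i \in spike_set p.+1 s ->
    marginal (observe (strong_signal p.+1 s B) (shift_head j t w)) i =
    marginal (observe (spiked_signal s B (t * B) j) w) i.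
  move=> iS; rewrite /marginal; congr (_ / _); apply: eq_bigr => k _.
  rewrite /= !tnth_mktuple (negbTE (S0 i iS)) addr0; congr (_ * (_ + _)).
  rewrite sum_spiked_signal//; under eq_bigr do rewrite !tnth_mktuple mulrDl.
  rewrite big_split/=; congr (_ + _).
    by apply: eq_bigr => l _; rewrite tnth_mktuple.
  rewrite (bigD1 ord0)//= big1 ?addr0; last first.
    by move=> l /negbTE ->; rewrite mul0r.
  have s1' : (0 < s.-1)%N by rewrite -subn1 subn_gt0.
  by rewrite s1' /= mulrAC.
have lt_eq (x x' y y' : R) : x = x' -> y = y' -> `|x'| < `|y'| -> `|x| < `|y|.
  by move=> -> ->.
by move=> L i iS ij; exact: lt_eq (E i iS) (E j jS) (L i iS ij).
Qed.

(** The supremum over the signal class dominates the average over the [p - s.-1]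
    spiked signals.  The map [phi j t] turns the noise and design under the
    strong signal into data on which position [j] leads whenever it leads under
    the spiked signal. *)
Lemma ms_minimax_risk_ge n p s (a B t th lam u : R)
    (phi : 'I_p -> R -> design R n p * n.-tuple R -> design R n p * n.-tuple R)
    (U : 'I_p -> design R n p * n.-tuple R -> R) :
  (0 < s <= p)%N -> 0 < a -> a <= B -> 0 <= th ->
  u = th * (1 + th) * t ^+ 2 -> u < 1 ->
  (forall j, measurable_fun setT (U j)) ->
  (forall j, measurable_fun setT (phi j t)) ->
  (forall j, j \in spike_set p s ->
    gaussian_tilt (design_noise_law R n p) (phi j) (U j) (col_sqnorm j)) ->
  (forall j w, j \in spike_set p s ->
    leading s j (observe (spiked_signal s B a j) w) ->
    leading s j (observe (strong_signal p s B) (phi j t w))) ->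
  ((1 - (expR lam / (p - s.-1)%:R +
        expR (n%:R * (u / (1 - u) / 2) - th * lam)))%:E <=
   ms_minimax_risk n p s a)%E.
Proof.
move=> /andP[s0 sp] a0 aB th0 uE u1 mU mphi tilt lead.
have B0 : 0 < B by exact: lt_le_trans aB.
have sp' : (s.-1 <= p)%N by rewrite (leq_trans _ sp)// leq_pred.
have u0 : 0 <= u by rewrite uE mulr_ge0 ?sqr_ge0// mulr_ge0// addr_ge0.
set C := expR (_ - _).
pose Q := design_noise_law R n p.
pose D (j : 'I_p) : set (design R n p * n.-tuple R) :=
  observe (strong_signal p s B) @^-1` leading s j.
have mobs beta (A : set (sample R n p)) : measurable A ->
    measurable (observe beta @^-1` A).
  by move=> mA; rewrite -[X in measurable X]setTI; exact: measurable_observe.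
have mD j : measurable (D j) by apply: mobs; exact: measurable_leading.
have mphiD j : measurable (phi j t @^-1` D j).
  by rewrite -[X in measurable X]setTI; exact: mphi.
have dD i j : i \in spike_set p s -> j \in spike_set p s -> i != j ->
    D i `&` D j = set0.
  by move=> iS jS ij; rewrite /D -preimage_setI leading_disjoint// preimage_set0.
have moment (j : 'I_p) : j \in spike_set p s ->
    (\int[Q]_w (expR (th * (1 + th) * t ^+ 2 * col_sqnorm j w / 2))%:E <=
     (expR (n%:R * (u / (1 - u) / 2)))%:E)%E.
  by move=> _; rewrite -uE; apply: le_integral_expR_col_sqnorm; rewrite u0.
have := sum_tilted_disjoint_le lam mD dD mU
  (fun j => @measurable_col_sqnorm R n p j) tilt (fun j _ => mphiD j) th0 moment.
rewrite -/C card_spike_set// => sumD.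
apply/ereal_infP => _ [tau [mtau tau0] <-].
set M := ereal_sup _.
have Mge beta : signal_class s a beta -> (error_prob tau beta <= M)%E.
  by move=> Hb; apply: ereal_sup_ubound; exists beta.
have M1 : (M <= 1)%E.
  by apply: ge_ereal_sup => _ [beta _ <-]; exact: error_prob_le1.
have errge j : j \in spike_set p s -> (1 - Q (phi j t @^-1` D j) <= M)%E.
  move=> jS; apply: le_trans (Mge _ (spiked_signal_class s0 a0 aB jS)).
  have mrec := measurable_recovery (Defs.support (spiked_signal s B a j)) mtau.
  rewrite error_probE//; apply: leeB => //.
  apply: (@le_measure _ _ _ Q (observe (spiked_signal s B a j) @^-1` _)).
  - by rewrite inE; exact: mobs.
  - by rewrite inE.
  move=> w /= rec; apply: lead => //.
  by apply: recovery_leading rec; rewrite gt_eqF.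
have Mfin : M \is a fin_num.
  rewrite ge0_fin_numE; first by rewrite (le_lt_trans M1)// ltry.
  have jP : (s.-1 < p)%N by rewrite prednK.
  have jS : Ordinal jP \in spike_set p s by rewrite inE.
  apply: le_trans (errge _ jS); rewrite sube_ge0 ?orbT//.
  exact: probability_le1.
pose q j := fine (Q (phi j t @^-1` D j)).
have qE j : Q (phi j t @^-1` D j) = (q j)%:E by rewrite fineK// fin_num_measure.
rewrite -(fineK Mfin) lee_fin.
have m0 : 0 < (p - s.-1)%:R :> R by rewrite ltr0n subn_gt0 prednK.
have qM : \sum_(j in spike_set p s) (1 - q j) <=
    \sum_(j in spike_set p s) fine M.
  apply: ler_sum => j jS; have := errge j jS.
  by rewrite qE -(fineK Mfin) -EFinD lee_fin.
move: sumD; under eq_bigr do rewrite qE.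
rewrite sumEFin lee_fin => sumq.
move: qM; rewrite sumrB !sumr_const card_spike_set// -(mulr_natl (fine M)) => qM.
rewrite -(ler_pM2l m0) mulrBr mulrDr mulr1 mulrCA divff ?gt_eqF// mulr1.
lra.
Qed.

End prior.

Section risk.
Variable R : realType.

(** A single weak coordinate is absorbed by the noise. *)
Lemma ms_minimax_risk_ge_single n p (a th lam u : R) :
  (0 < p)%N -> 0 < a -> 0 <= th -> u = th * (1 + th) * a ^+ 2 -> u < 1 ->
  ((1 - (expR lam / p%:R + expR (n%:R * (u / (1 - u) / 2) - th * lam)))%:E <=
   ms_minimax_risk n p 1 a)%E.
Proof.
move=> p0 a0 th0 uE u1; rewrite -[X in X%:R]subn0.
apply: (@ms_minimax_risk_ge R n p 1 a a a th lam u (@shift_noise R n p)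
  (@col_dot_noise R n p)) => //.
- by move=> j; exact: measurable_col_dot_noise.
- by move=> j; exact: measurable_shift_noise.
- by move=> j _; exact: gaussian_tilt_noise.
- by move=> j w jS; rewrite observe_spiked_noise.
Qed.

(** With a strong coordinate available, a weak coordinate of size [t * B] has the
    likelihood ratio of a signal of size [t], however large [B] is. *)
Lemma ms_minimax_risk_ge_multi n p s (t B th lam u : R) :
  (1 < s <= p)%N -> 0 < t <= 1 -> 0 < B -> 0 <= th ->
  u = th * (1 + th) * t ^+ 2 -> u < 1 ->
  ((1 - (expR lam / (p - s.-1)%:R +
         expR (n%:R * (u / (1 - u) / 2) - th * lam)))%:E <=
   ms_minimax_risk n p s (t * B))%E.
Proof.
case: p => [|p]; first by case: s => [|[]].
move=> /andP[s1 sp] /andP[t0 t1] B0 th0 uE u1.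
apply: (@ms_minimax_risk_ge R n p.+1 s (t * B) B t th lam u
  (@shift_head R n p) (@col_dot_head R n p)) => //.
- by rewrite sp andbT ltnW.
- exact: mulr_gt0.
- by rewrite ler_piMl// ltW.
- by move=> j; exact: measurable_col_dot_head.
- by move=> j; exact: measurable_shift_head.
- move=> j; rewrite inE => sj; apply: gaussian_tilt_head.
  apply/eqP => j0; move: sj.
  by rewrite j0 leqn0 -subn1 subn_eq0 leqNgt s1.
- by move=> j w jS; exact: leading_observe_spiked_head.
Qed.

Lemma ms_minimax_risk_le1 n p s (a : R) : (ms_minimax_risk n p s a <= 1)%E.
Proof.
pose tau (xy : sample R n p) : R := 0.
have mtau : measurable_fun setT tau by exact: measurable_cst.
apply: (@le_trans _ _ (ereal_sup [set error_prob tau beta |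
    beta in @signal_class R p s a])).
  by apply: ereal_inf_lbound; exists tau => //; split.
apply: ge_ereal_sup => _ [beta _ <-]; exact: error_prob_le1.
Qed.

End risk.

(** * Asymptotics *)

Section asymptotics.
Variable R : realType.

(** Parameters [th], [lam], [u] for which the lower bound on the minimax risk
    given by a tilt of size [t] is at least [1 - e], as soon as at least [p / 2]
    positions are available to the weak coordinate. *)
Definition tilt_budget (n p : nat) (t e : R) :=
  exists th lam u : R,
    [/\ 0 <= th, u = th * (1 + th) * t ^+ 2, u < 1 &
      forall m : R, p%:R / 2 <= m ->
        expR lam / m + expR (n%:R * (u / (1 - u) / 2) - th * lam) <= e].

Lemma near_ln_ge (K : R) : \forall p \near \oo, K <= ln (p%:R : R).
Proof.
near=> p.
have pK : expR K <= p%:R by near: p; exact: nbhs_infty_ger.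
by rewrite -ler_expR lnK// posrE (lt_le_trans _ pK)// expR_gt0.
Unshelve. all: by end_near. Qed.

(** From [expR z >= z] at [z = k * ln p / 2] one gets
    [p `^ k >= (k * ln p / 2) ^+ 2], which beats any multiple of [ln p]. *)
Lemma near_ln_le_sample_size (k e : R) : 0 < k -> 0 < e ->
  \forall p \near \oo, ln p%:R <= e * (sample_size k p)%:R.
Proof.
move=> k0 e0; near=> p.
set L := ln p%:R.
have LK : 8 / (e * k ^+ 2) <= L by rewrite /L; near: p; exact: near_ln_ge.
have L0 : 0 < L by rewrite (lt_le_trans _ LK)// divr_gt0// mulr_gt0// exprn_gt0.
have p0 : p%:R != 0 :> R.
  by apply/eqP => pE; move: L0; rewrite /L pE ln0// ltxx.
rewrite /sample_size /powR (negbTE p0) -/L.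
set N := Num.truncn _.
have kL0 : 0 < k * L by rewrite mulr_gt0.
(* Truncation loses at most a factor 2 because [p `^ k] is at least 1. *)
have N1 : (0 < N)%N by rewrite truncn_gt0 -[leLHS]expR0 ler_expR ltW.
have NL : expR (k * L) <= 2 * N%:R.
  apply: ltW; apply: lt_le_trans (truncnS_gt _) _.
  by rewrite -/N -[leLHS]natr1 mulr_natl mulr2n lerD2l ler1n.
have sq : (k * L / 2) ^+ 2 <= expR (k * L).
  have -> : expR (k * L) = expR (k * L / 2) ^+ 2.
    by rewrite -expRM_natr; congr expR; field.
  rewrite ler_sqr ?nnegrE ?expR_ge0 ?divr_ge0 ?(ltW kL0)//.
  by apply: le_trans (expR_ge1Dx _); rewrite lerDr.
rewrite ler_pdivrMr ?mulr_gt0 ?exprn_gt0// in LK.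
have : 8 * L <= e * (k * L) ^+ 2.
  by have := ler_wpM2r (ltW L0) LK; lra.
have : e * (k * L / 2) ^+ 2 <= e * (2 * N%:R).
  by rewrite ler_pM2l//; exact: le_trans sq NL.
lra.
Unshelve. all: by end_near. Qed.

Lemma sqr_signal_level (k r : R) p : 0 <= r -> 0 <= ln p%:R :> R ->
  signal_level k r p ^+ 2 = 2 * r * ln p%:R / (sample_size k p)%:R.
Proof. by move=> r0 L0; rewrite sqr_sqrtr// divr_ge0// !mulr_ge0. Qed.

(** Write [L] for [ln p], so that [n t^2 = 2 r L].  With [lam = mu L] the first
    term is of order [p^(mu - 1)]; once [u] is so small that
    [1 / (1 - u) <= 1 + th], the second is at most [p^(- th kappa)] with
    [kappa = mu - (1 + th)^2 r].  Hence [mu] is taken midway between [r] and 1,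
    and [th] small enough for [kappa] to be positive. *)
Lemma near_tilt_budget (k r e : R) : 0 < k -> 0 < r < 1 -> 0 < e ->
  \forall p \near \oo, tilt_budget (sample_size k p) p (signal_level k r p) e.
Proof.
move=> k0 /andP[r0 r1] e0.
pose th := (1 - r) / 8; pose mu := (1 + r) / 2.
have th0 : 0 < th by rewrite /th divr_gt0// subr_gt0.
have th1 : 0 < 1 + th by rewrite addr_gt0.
have c0 : 0 < 2 * r * (1 + th) ^+ 2 by rewrite mulr_gt0 ?exprn_gt0// mulr_gt0.
pose kappa := mu - (1 + th) ^+ 2 * r.
have kappa0 : 0 < kappa.
  rewrite /kappa /mu /th; move: r0 r1; clear; move=> r0 r1; nra.
near=> p.
pose L : R := ln p%:R; pose n : R := (sample_size k p)%:R.
rewrite -/n.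
have L1 : 1 <= L by rewrite /L; near: p; exact: near_ln_ge.
have L0 : 0 < L by rewrite (lt_le_trans _ L1).
have Ln : L <= (2 * r * (1 + th) ^+ 2)^-1 * n.
  rewrite /L /n; near: p; apply: near_ln_le_sample_size => //.
  by rewrite invr_gt0.
have n0 : 0 < n.
  have ci0 : 0 < (2 * r * (1 + th) ^+ 2)^-1 by rewrite invr_gt0.
  by rewrite -(pmulr_rgt0 _ ci0) (lt_le_trans L0).
have Le1 : ln (4 / e) <= (1 - mu) * L.
  rewrite [leRHS]mulrC -ler_pdivrMr; last by rewrite /mu; lra.
  by rewrite /L; near: p; exact: near_ln_ge.
have Le2 : ln (2 / e) <= th * kappa * L.
  rewrite [leRHS]mulrC -ler_pdivrMr; last exact: (mulr_gt0 th0 kappa0).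
  by rewrite /L; near: p; exact: near_ln_ge.
have p0 : 0 < p%:R :> R.
  by rewrite ltr0n lt0n; apply/eqP => pE; move: L0; rewrite /L pE ln0// ltxx.
pose u := th * (1 + th) * signal_level k r p ^+ 2.
have uE : u = th * (1 + th) * (2 * r * L / n).
  by rewrite /u sqr_signal_level// ltW.
have u0 : 0 < u.
  by rewrite uE mulr_gt0 ?divr_gt0// mulr_gt0// mulr_gt0.
have uth : u * (1 + th) <= th.
  have : 2 * r * (1 + th) ^+ 2 * L <= n.
    by rewrite -ler_pdivlMl.
  move=> H; rewrite uE !mulrA mulrAC ler_pdivrMr//.
  have : th * (2 * r * (1 + th) ^+ 2 * L) <= th * n by rewrite ler_pM2l.
  lra.
have u1 : u < 1 by nra.
have iu : (1 - u)^-1 <= 1 + th.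
  by rewrite -[leLHS]mul1r ler_pdivrMr ?subr_gt0//; lra.
have nu : n * (u / (1 - u) / 2) <= th * (1 + th) ^+ 2 * r * L.
  have -> : n * (u / (1 - u) / 2) = th * (1 + th) * r * L * (1 - u)^-1.
    by rewrite [X in X / (1 - u)]uE; field; rewrite subr_eq0 !gt_eqF.
  have -> : th * (1 + th) ^+ 2 * r * L = th * (1 + th) * r * L * (1 + th).
    by ring.
  by rewrite ler_pM2l// mulr_gt0// mulr_gt0// mulr_gt0.
exists th, (mu * L), u; split => //; first exact: (ltW th0).
move=> m pm.
have m0 : 0 < m by rewrite (lt_le_trans _ pm)// divr_gt0.
have t1 : expR (mu * L) / m <= e / 2.
  rewrite ler_pdivrMr//; apply: (@le_trans _ _ (e / 2 * (p%:R / 2))); last first.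
    by rewrite ler_pM2l// divr_gt0.
  have pE : p%:R = expR L by rewrite lnK.
  have eE : e = 4 * expR (- ln (4 / e)).
    by rewrite expRN lnK ?posrE ?divr_gt0// invf_div mulrC divfK.
  rewrite {1}eE pE.
  have -> : 4 * expR (- ln (4 / e)) / 2 * (expR L / 2) = expR (- ln (4 / e) + L).
    by rewrite expRD; field.
  by rewrite ler_expR; lra.
have t2 : expR (n * (u / (1 - u) / 2) - th * (mu * L)) <= e / 2.
  have -> : e / 2 = expR (- ln (2 / e)).
    by rewrite expRN lnK ?posrE ?divr_gt0// invf_div.
  rewrite ler_expR; apply: le_trans (lerD nu (lexx _)) _.
  have -> : th * (1 + th) ^+ 2 * r * L - th * (mu * L) = - (th * kappa * L).
    by rewrite /kappa; ring.
  by rewrite lerN2.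
lra.
Unshelve. all: by end_near. Qed.

Lemma near_sparsity_le_half (s : nat -> nat) :
  (fun p : nat => (s p)%:R : R^o) =O_\oo (fun p : nat => ln p%:R : R^o) ->
  \forall p \near \oo, (s p)%:R <= p%:R / 2 :> R.
Proof.
move=> /eqO_exP[C C0 sC].
have iC0 : 0 < (2 * C)^-1 by rewrite invr_gt0 mulr_gt0.
have lnC := near_ln_le_sample_size ltr01 iC0.
near=> p.
have L0 : 0 <= ln p%:R :> R by near: p; exact: near_ln_ge.
have sL : (s p)%:R <= C * ln p%:R :> R.
  have : `|(s p)%:R : R^o| <= C * `|ln p%:R : R^o| by near: p.
  by rewrite ger0_norm// ger0_norm.
have Lp : ln p%:R <= (2 * C)^-1 * p%:R :> R.
  have : ln p%:R <= (2 * C)^-1 * (sample_size (1 : R) p)%:R :> R by near: p; exact: lnC.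
  by rewrite /sample_size powRr1// natrK.
apply: le_trans sL _.
have -> : p%:R / 2 = C * ((2 * C)^-1 * p%:R) :> R by field; rewrite gt_eqF.
by rewrite ler_pM2l.
Unshelve. all: by end_near. Qed.

End asymptotics.

(** * The limit of the minimax risk *)

Lemma cvge1_near_ge (R : realType) (f : nat -> \bar R) :
  (forall p, f p <= 1)%E ->
  (forall e : R, 0 < e -> \forall p \near \oo, ((1 - e)%:E <= f p)%E) ->
  f @ \oo --> 1%E.
Proof.
move=> f1 H.
have fin : \forall p \near \oo, f p \is a fin_num.
  near=> p; rewrite ge0_fin_numE; first by rewrite (le_lt_trans (f1 p))// ltry.
  have lo : ((1 - 1)%:E <= f p)%E by near: p; exact: (H 1 ltr01).
  by rewrite subrr in lo.
apply/fine_cvgP; split=> //.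
apply/cvgrPdist_le => e e0; near=> p.
have pfin : f p \is a fin_num by near: p; exact: fin.
have lo : ((1 - e)%:E <= f p)%E by near: p; exact: H.
have := f1 p; rewrite -(fineK pfin) lee_fin in lo *.
rewrite lee_fin /= => hi.
by rewrite ger0_norm ?subr_ge0//; lra.
Unshelve. all: by end_near. Qed.

(** [Num.sqrt (2 * r)] is the size of the strong coordinates that turns a signal
    of strength [r] into a tilt of strength [1 / 2]. *)
Lemma signal_level_rescale (R : realType) (k r : R) p : 0 <= r ->
  0 <= ln p%:R :> R ->
  signal_level k r p = signal_level k (1 / 2) p * Num.sqrt (2 * r).
Proof.
move=> r0 L0; rewrite /signal_level -sqrtrM; last first.
  by rewrite divr_ge0// !mulr_ge0.
by congr Num.sqrt; rewrite [2 * (1 / 2)]mulrCA divff// mulr1 mul1r; ring.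
Qed.

Theorem theorem3p1 (R : realType) (k r : R) (s : nat -> nat)
    (hk0 : 0 < k) (hk1 : k < 1) (hr : 0 < r)
    (hsO : (fun p : nat => (s p)%:R : R^o) =O_\oo (fun p : nat => ln p%:R : R^o))
    (hs : \forall p \near \oo, (2 <= s p)%N \/ s p = 1%N /\ r < 1) :
  (fun p : nat =>
     @ms_minimax_risk R (sample_size k p) p (s p) (signal_level k r p))
    @ \oo --> 1%E.
Proof.
apply: cvge1_near_ge => [p|e e0]; first exact: ms_minimax_risk_le1.
have h01 : 0 < (1 / 2 : R) < 1 by apply/andP; split; lra.
have Hhalf := near_tilt_budget hk0 h01 e0.
have Hr : \forall p \near \oo, r < 1 ->
    tilt_budget (sample_size k p) p (signal_level k r p) e.
  have [r1|r1] := ltP r 1; last by apply: nearW.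
  have r01 : 0 < r < 1 by rewrite hr.
  by apply: filterS (near_tilt_budget hk0 r01 e0) => p ? _.
have Hs := near_sparsity_le_half hsO.
near=> p.
have L1 : 1 <= ln p%:R :> R by near: p; exact: near_ln_ge.
have Ln : ln p%:R <= (1 : R) * (sample_size k p)%:R.
  by near: p; exact: near_ln_le_sample_size.
rewrite mul1r in Ln.
have L0 : 0 < ln p%:R :> R by exact: lt_le_trans L1.
have n0 : 0 < (sample_size k p)%:R :> R by exact: lt_le_trans Ln.
have level0 (q : R) : 0 < q -> 0 < signal_level k q p.
  by move=> q0; rewrite sqrtr_gt0 divr_gt0// mulr_gt0// mulr_gt0.
have p0 : (0 < p)%N.
  by rewrite lt0n; apply/eqP => pE; move: L0; rewrite pE ln0// ltxx.
have sp : (s p)%:R <= p%:R / 2 :> R by near: p; exact: Hs.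
have : (2 <= s p)%N \/ s p = 1%N /\ r < 1 by near: p.
case=> [s2|[-> r1]]; last first.
  have : r < 1 -> tilt_budget (sample_size k p) p (signal_level k r p) e.
    by near: p; exact: Hr.
  move=> /(_ r1)[th [lam [u [th0 uE u1 He]]]].
  apply: le_trans (ms_minimax_risk_ge_single _ lam p0 (level0 r hr) th0 uE u1).
  rewrite lee_fin lerB// He//.
  by rewrite ler_pdivrMr// ler_peMr ?ler1n ?ler0n.
have [th [lam [u [th0 uE u1 He]]]] :
    tilt_budget (sample_size k p) p (signal_level k (1 / 2) p) e.
  by near: p; exact: Hhalf.
have sp' : (s p <= p)%N.
  by rewrite -(ler_nat R) (le_trans sp)// ler_pdivrMr// ler_peMr ?ler1n ?ler0n.
(* [a <= B] amounts to [t <= 1], which holds once [ln p <= n]. *)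
have t1 : signal_level k (1 / 2) p <= 1.
  rewrite -[leRHS]sqrtr1 ler_wsqrtr// [2 * (1 / 2)]mulrCA divff// mulr1 mul1r.
  by rewrite ler_pdivrMr// mul1r.
rewrite (signal_level_rescale k (ltW hr) (ltW L0)).
have sB : 0 < Num.sqrt (2 * r) by rewrite sqrtr_gt0 mulr_gt0.
have s2p : (1 < s p <= p)%N by rewrite s2.
have t01 : 0 < signal_level k (1 / 2) p <= 1 by rewrite level0// divr_gt0.
apply: le_trans (ms_minimax_risk_ge_multi _ lam s2p t01 sB th0 uE u1).
rewrite lee_fin lerB// He// natrB ?(leq_trans (leq_pred _))//.
have : (s p).-1%:R <= (s p)%:R :> R by rewrite ler_nat leq_pred.
lra.
Unshelve. all: by end_near. Qed.
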